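(* There is a computable translation which maps every $\mathrm{LRP}^2$ formula $\phi$ over a vocabulary $\tau$ to a finite disjunction of $\mathrm{NLRP}^2$ formulas over a vocabulary $\tau'$ obtained from $\tau$ by adding new constant symbols, such that $\phi$ is satisfiable if and only if the resulting disjunction is satisfiable.
   Context: A vocabulary is $\tau=\langle C,U,F\rangle$, where $C$ is a finite set of constant symbols, $U$ a set of unary relation symbols and $F$ a finite set of binary relation symbols (edge labels). A graph (interpretation) over $\tau$ is $G=\langle V,E,C^G,U^G\rangle$ with $V$ a set of nodes, $E(f)\subseteq V\times V$ for $f\in F$, $C^G(c)\in V$ for $c\in C$, and $U^G(u)\subseteq V$ for $u\in U$. Terms are variables or constants; atomic formulas are $t=t'$, $u(t)$ and $t\xrightarrow{f}t'$ (meaning $(t,t')\in E(f)$); quantifier-free formulas are Boolean combinations of atomic formulas. Routing expressions are given by the grammar $R::=\emptyset\mid\epsilon\mid \xrightarrow{f}\mid \xleftarrow{f}\mid u\mid\neg u\mid c\mid \neg c\mid R_1.R_2\mid R_1|R_2\mid R^*$ ($f\in F,u\in U,c\in C$), denoting a language $L(R)$ of words over the letters $\xrightarrow{f},\xleftarrow{f},u,\neg u,c,\neg c$. A path labelled by a word $w$ from node $a$ to node $b$ is defined by: $\epsilon$: $a=b$; $\xrightarrow{f}$: $(a,b)\in E(f)$; $\xleftarrow{f}$: $(b,a)\in E(f)$; $u$: $a=b\in U^G(u)$; $\neg u$: $a=b\notin U^G(u)$; $c$: $a=b=C^G(c)$; $\neg c$: $a=b\neq C^G(c)$; and a word $w_1w_2$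 labels a path from $a$ to $b$ iff there is a node $d$ with a $w_1$-path from $a$ to $d$ and a $w_2$-path from $d$ to $b$. An $R$-path is a path labelled by some word of $L(R)$. A neighborhood formula $N(v_0,\dots,v_n)$ is a conjunction of edge atoms $v_i\xrightarrow{f}v_j$. A reachability constraint, written $[c,R]p$, is a closed formula $\forall v_0,\dots,v_n.\ R(c,v_0)\Rightarrow(N(v_0,\dots,v_n)\Rightarrow\psi(v_0,\dots,v_n))$ where $c\in C$, $R$ is a routing expression, $N$ is a neighborhood formula, $\psi$ is quantifier-free, the free variables of $N$ are among $v_0,\dots,v_n$ and those of $\psi$ are among $FV(N)\cup\{v_0\}$; $p(v_0):=N\Rightarrow\psi$ is its pattern. A graph $G$ satisfies it iff for every node $a$ reachable by an $R$-path from $C^G(c)$ and every assignment of nodes to $v_0,\dots,v_n$ with $v_0\mapsto a$, the assignment satisfies $N\Rightarrow\psi$. An $\mathrm{LRP}$ formula is a Boolean combination of reachability constraints. For $c_1,c_2\in C$, $\langle c_1,R\rangle c_2$ denotes the negation of the reachability constraint $[c_1,R]p$ with $p(v_0):=\mathit{true}\Rightarrow\neg(v_0=c_2)$; it states that there is an $R$-path from $C^G(c_1)$ to $C^G(c_2)$. The Gaifman graph $B_N$ of a neighborhood formula $N$ is the undirected graph on its free variables with an arc between $v_i$ and $v_j$ iff some atom $v_i\xrightarrow{f}v_j$ occurs in $N$; the distance between two variables in $N$ is their edge distance in $B_N$. A pattern $N\Rightarrow\psi$ is $\mathrm{LRP}^2$-admissible if $\psi$ is either (equality pattern) $v_i=v_j$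 with distance between $v_i,v_j$ in $N$ at most $2$, or (edge pattern) $v_i\xrightarrow{f}v_j$ with distance between $v_i,v_j$ in $N$ at most $1$, or (negative pattern) a quantifier-free formula in which atomic formulas occur only negatively. An $\mathrm{LRP}$ formula is in $\mathrm{LRP}^2$ if all patterns of its reachability constraints are $\mathrm{LRP}^2$-admissible. An $\mathrm{NLRP}^2$ formula is a conjunction of formulas each of the form $\langle c_1,R\rangle c_2$ or $[c,R]p$ with $p$ an $\mathrm{LRP}^2$-admissible pattern. *)

(* Defs.v *)
From Stdlib Require Import Relations.
From mathcomp Require Import all_boot.

Set Implicit Arguments.
Unset Strict Implicit.
Unset Printing Implicit Defensive.

(* [Unary] may be infinite; its symbols need finite names to be handled by an
   algorithm, whence [countType]. *)
Record vocabulary := Vocabulary {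
  Const : finType;
  Unary : countType;
  Label : finType
}.

Definition add_constants (tau : vocabulary) (k : nat) : vocabulary :=
  Vocabulary (Const tau + 'I_k)%type (Unary tau) (Label tau).

Record graph (tau : vocabulary) := Graph {
  node : Type;
  edge : Label tau -> node -> node -> Prop;
  const : Const tau -> node;
  unary : Unary tau -> node -> Prop
}.

Inductive term (tau : vocabulary) (n : nat) :=
| TVar of 'I_n.+1
| TConst of Const tau.

Inductive atom (tau : vocabulary) (n : nat) :=
| AEq of term tau n & term tau n
| AUnary of Unary tau & term tau n
| AEdge of term tau n & Label tau & term tau n.

Inductive qf (tau : vocabulary) (n : nat) :=
| QTrue
| QFalse
| QAtom of atom tau n
| QNot of qf tau n
| QAnd of qf tau n & qf tau n
| QOr of qf tau n & qf tau n.

Arguments TVar {tau n}.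
Arguments TConst {tau n}.
Arguments QTrue {tau n}.
Arguments QFalse {tau n}.

Definition term_vars tau n (t : term tau n) : seq 'I_n.+1 :=
  if t is TVar i then [:: i] else [::].

Definition atom_vars tau n (A : atom tau n) : seq 'I_n.+1 :=
  match A with
  | AEq t t' => term_vars t ++ term_vars t'
  | AUnary _ t => term_vars t
  | AEdge t _ t' => term_vars t ++ term_vars t'
  end.

Fixpoint qf_vars tau n (psi : qf tau n) : seq 'I_n.+1 :=
  match psi with
  | QTrue | QFalse => [::]
  | QAtom A => atom_vars A
  | QNot p => qf_vars p
  | QAnd p q | QOr p q => qf_vars p ++ qf_vars q
  end.

(* [pos] is the polarity of the context in which [psi] stands. *)
Fixpoint atoms_negative_in tau n (pos : bool) (psi : qf tau n) : bool :=
  match psi with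
  | QTrue | QFalse => true
  | QAtom _ => ~~ pos
  | QNot p => atoms_negative_in (~~ pos) p
  | QAnd p q | QOr p q => atoms_negative_in pos p && atoms_negative_in pos q
  end.

Definition only_negative tau n (psi : qf tau n) : bool :=
  atoms_negative_in true psi.

Definition term_val tau n (G : graph tau) (rho : 'I_n.+1 -> node G)
    (t : term tau n) : node G :=
  match t with TVar i => rho i | TConst c => const G c end.

Definition atom_sat tau n (G : graph tau) (rho : 'I_n.+1 -> node G)
    (A : atom tau n) : Prop :=
  match A with
  | AEq t t' => term_val rho t = term_val rho t'
  | AUnary u t => unary u (term_val rho t)
  | AEdge t f t' => edge f (term_val rho t) (term_val rho t')
  end.

Fixpoint qf_sat tau n (G : graph tau) (rho : 'I_n.+1 -> node G)
    (psi : qf tau n) : Prop :=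
  match psi with
  | QTrue => True
  | QFalse => False
  | QAtom A => atom_sat rho A
  | QNot p => ~ qf_sat rho p
  | QAnd p q => qf_sat rho p /\ qf_sat rho q
  | QOr p q => qf_sat rho p \/ qf_sat rho q
  end.

Inductive letter (tau : vocabulary) :=
| LFwd of Label tau
| LBwd of Label tau
| LUnary of Unary tau
| LNotUnary of Unary tau
| LConst of Const tau
| LNotConst of Const tau.

Inductive routing (tau : vocabulary) :=
| REmpty
| REps
| RLetter of letter tau
| RCat of routing tau & routing tau
| RAlt of routing tau & routing tau
| RStar of routing tau.

Arguments REmpty {tau}.
Arguments REps {tau}.

Inductive lang tau : routing tau -> seq (letter tau) -> Prop :=
| lang_eps : lang REps [::]
| lang_letter l : lang (RLetter l) [:: l]
| lang_cat R1 R2 w1 w2 : lang R1 w1 -> lang R2 w2 -> lang (RCat R1 R2) (w1 ++ w2)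
| lang_altl R1 R2 w : lang R1 w -> lang (RAlt R1 R2) w
| lang_altr R1 R2 w : lang R2 w -> lang (RAlt R1 R2) w
| lang_star0 R : lang (RStar R) [::]
| lang_starS R w1 w2 :
    lang R w1 -> lang (RStar R) w2 -> lang (RStar R) (w1 ++ w2).

Definition letter_step tau (G : graph tau) (l : letter tau) (a b : node G) : Prop :=
  match l with
  | LFwd f => edge f a b
  | LBwd f => edge f b a
  | LUnary u => a = b /\ unary u b
  | LNotUnary u => a = b /\ ~ unary u b
  | LConst c => a = b /\ b = const G c
  | LNotConst c => a = b /\ b <> const G c
  end.

Fixpoint word_path tau (G : graph tau) (w : seq (letter tau)) (a b : node G) : Prop :=
  if w is l :: w' then exists d, letter_step l a d /\ word_path w' d b else a = b.

Definition routing_path tau (G : graph tau) (R : routing tau) (a b : node G) : Prop :=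
  exists w, lang R w /\ word_path w a b.

(* ((i, f), j) stands for the atom v_i -f-> v_j. *)
Definition nbhd (tau : vocabulary) (n : nat) :=
  seq ('I_n.+1 * Label tau * 'I_n.+1).

Definition nbhd_vars tau n (N : nbhd tau n) : seq 'I_n.+1 :=
  flatten [seq [:: e.1.1; e.2] | e <- N].

Definition nbhd_sat tau n (G : graph tau) (rho : 'I_n.+1 -> node G)
    (N : nbhd tau n) : Prop :=
  forall e, e \in N -> edge e.1.2 (rho e.1.1) (rho e.2).

Record pattern (tau : vocabulary) := Pattern {
  pdim : nat;
  pnbhd : nbhd tau pdim;
  pconcl : qf tau pdim;
  pvarsP : all (mem (ord0 :: nbhd_vars pnbhd)) (qf_vars pconcl)
}.

Definition gaifman tau n (N : nbhd tau n) : rel 'I_n.+1 :=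
  fun i j => has (fun e => ((e.1.1 == i) && (e.2 == j))
                        || ((e.1.1 == j) && (e.2 == i))) N.

(* The vertices of the Gaifman graph are the free variables of N, so the
   distance is only defined between those. *)
Definition dist_le tau n (N : nbhd tau n) (d : nat) (i j : 'I_n.+1) : Prop :=
  [/\ i \in nbhd_vars N, j \in nbhd_vars N
    & exists p : seq 'I_n.+1,
        [/\ size p <= d, path (gaifman N) i p & last i p = j]].

Definition equality_pattern tau (p : pattern tau) : Prop :=
  exists i j, pconcl p = QAtom (AEq (TVar i) (TVar j)) /\ dist_le (pnbhd p) 2 i j.

Definition edge_pattern tau (p : pattern tau) : Prop :=
  exists i f j,
    pconcl p = QAtom (AEdge (TVar i) f (TVar j)) /\ dist_le (pnbhd p) 1 i j.

Definition negative_pattern tau (p : pattern tau) : Prop := only_negative (pconcl p).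

Definition LRP2_admissible tau (p : pattern tau) : Prop :=
  [\/ equality_pattern p, edge_pattern p | negative_pattern p].

Inductive LRP (tau : vocabulary) :=
| FTrue
| FFalse
| FReach of Const tau & routing tau & pattern tau
| FNot of LRP tau
| FAnd of LRP tau & LRP tau
| FOr of LRP tau & LRP tau.

Arguments FTrue {tau}.
Arguments FFalse {tau}.

Definition reach_sat tau (G : graph tau) (c : Const tau) (R : routing tau)
    (p : pattern tau) : Prop :=
  forall a : node G, routing_path R (const G c) a ->
  forall rho : 'I_(pdim p).+1 -> node G, rho ord0 = a ->
  nbhd_sat rho (pnbhd p) -> qf_sat rho (pconcl p).

Fixpoint LRP_sat tau (G : graph tau) (phi : LRP tau) : Prop :=
  match phi with
  | FTrue => True
  | FFalse => False
  | FReach c R p => reach_sat G c R p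
  | FNot a => ~ LRP_sat G a
  | FAnd a b => LRP_sat G a /\ LRP_sat G b
  | FOr a b => LRP_sat G a \/ LRP_sat G b
  end.

Definition satisfiable tau (phi : LRP tau) : Prop :=
  exists G : graph tau, LRP_sat G phi.

Fixpoint LRP2 tau (phi : LRP tau) : Prop :=
  match phi with
  | FTrue | FFalse => True
  | FReach _ _ p => LRP2_admissible p
  | FNot a => LRP2 a
  | FAnd a b | FOr a b => LRP2 a /\ LRP2 b
  end.

Definition neq_const_pattern tau (c : Const tau) : pattern tau :=
  @Pattern tau 0 [::] (QNot (QAtom (AEq (TVar ord0) (TConst c)))) isT.

Definition FDiamond tau (c1 : Const tau) (R : routing tau) (c2 : Const tau) : LRP tau :=
  FNot (FReach c1 R (neq_const_pattern c2)).

Inductive NLRP2 tau : LRP tau -> Prop :=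
| NLRP2_true : NLRP2 FTrue
| NLRP2_diamond c1 R c2 : NLRP2 (FDiamond c1 R c2)
| NLRP2_reach c R p : LRP2_admissible p -> NLRP2 (FReach c R p)
| NLRP2_and a b : NLRP2 a -> NLRP2 b -> NLRP2 (FAnd a b).

Definition disjunction tau (s : seq (LRP tau)) : LRP tau := foldr (@FOr tau) FFalse s.

Inductive tree := Leaf | Node of tree & tree.

Fixpoint tree_of_nat (n : nat) : tree :=
  if n is m.+1 then Node Leaf (tree_of_nat m) else Leaf.

Definition ctag (n : nat) (t : tree) : tree := Node (tree_of_nat n) t.

Definition tree_of_seq T (code : T -> tree) (s : seq T) : tree :=
  foldr (fun x t => Node (code x) t) Leaf s.

(* Constants and edge labels are named by their rank in the enumeration of the
   finite set they belong to, unary symbols by the number [pickle] assigns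
   them. In [add_constants tau k] the old constants keep their ranks and the
   new ones have the ranks #|Const tau|, ..., #|Const tau| + k - 1. *)
Definition code_const tau (c : Const tau) : tree := tree_of_nat (enum_rank c).
Definition code_label tau (f : Label tau) : tree := tree_of_nat (enum_rank f).
Definition code_unary tau (u : Unary tau) : tree := tree_of_nat (pickle u).
Definition code_var n (i : 'I_n.+1) : tree := tree_of_nat i.

Definition code_term tau n (t : term tau n) : tree :=
  match t with
  | TVar i => ctag 0 (code_var i)
  | TConst c => ctag 1 (code_const c)
  end.

Definition code_atom tau n (A : atom tau n) : tree :=
  match A with
  | AEq t t' => ctag 0 (Node (code_term t) (code_term t'))
  | AUnary u t => ctag 1 (Node (code_unary u) (code_term t))
  | AEdge t f t' => ctag 2 (Node (code_term t) (Node (code_label f) (code_term t')))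
  end.

Fixpoint code_qf tau n (psi : qf tau n) : tree :=
  match psi with
  | QTrue => ctag 0 Leaf
  | QFalse => ctag 1 Leaf
  | QAtom A => ctag 2 (code_atom A)
  | QNot p => ctag 3 (code_qf p)
  | QAnd p q => ctag 4 (Node (code_qf p) (code_qf q))
  | QOr p q => ctag 5 (Node (code_qf p) (code_qf q))
  end.

Definition code_letter tau (l : letter tau) : tree :=
  match l with
  | LFwd f => ctag 0 (code_label f)
  | LBwd f => ctag 1 (code_label f)
  | LUnary u => ctag 2 (code_unary u)
  | LNotUnary u => ctag 3 (code_unary u)
  | LConst c => ctag 4 (code_const c)
  | LNotConst c => ctag 5 (code_const c)
  end.

Fixpoint code_routing tau (R : routing tau) : tree :=
  match R with
  | REmpty => ctag 0 Leaf
  | REps => ctag 1 Leaf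
  | RLetter l => ctag 2 (code_letter l)
  | RCat R1 R2 => ctag 3 (Node (code_routing R1) (code_routing R2))
  | RAlt R1 R2 => ctag 4 (Node (code_routing R1) (code_routing R2))
  | RStar R1 => ctag 5 (code_routing R1)
  end.

Definition code_nbhd tau n (N : nbhd tau n) : tree :=
  tree_of_seq (fun e => Node (code_var e.1.1)
                             (Node (code_label e.1.2) (code_var e.2))) N.

Definition code_pattern tau (p : pattern tau) : tree :=
  Node (tree_of_nat (pdim p)) (Node (code_nbhd (pnbhd p)) (code_qf (pconcl p))).

Fixpoint code_LRP tau (phi : LRP tau) : tree :=
  match phi with
  | FTrue => ctag 0 Leaf
  | FFalse => ctag 1 Leaf
  | FReach c R p =>
      ctag 2 (Node (code_const c) (Node (code_routing R) (code_pattern p)))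
  | FNot a => ctag 3 (code_LRP a)
  | FAnd a b => ctag 4 (Node (code_LRP a) (code_LRP b))
  | FOr a b => ctag 5 (Node (code_LRP a) (code_LRP b))
  end.

Inductive lam :=
| Var of nat
| App of lam & lam
| Lam of lam.

Fixpoint closed_under (k : nat) (s : lam) : bool :=
  match s with
  | Var n => n < k
  | App s1 s2 => closed_under k s1 && closed_under k s2
  | Lam s1 => closed_under k.+1 s1
  end.

Definition closed_lam (s : lam) : bool := closed_under 0 s.

(* De Bruijn indices; [u] is not lifted under binders, which is correct since
   only closed terms are ever substituted when a closed term is reduced. *)
Fixpoint subst (s : lam) (k : nat) (u : lam) : lam :=
  match s with
  | Var n => if n == k then u else Var n
  | App s1 s2 => App (subst s1 k u) (subst s2 k u)
  | Lam s1 => Lam (subst s1 k.+1 u)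
  end.

Inductive step : lam -> lam -> Prop :=
| step_beta s t : step (App (Lam s) (Lam t)) (subst s 0 (Lam t))
| step_appl s s' t : step s s' -> step (App s t) (App s' t)
| step_appr s t t' : step t t' -> step (App s t) (App s t').

Definition reduces : lam -> lam -> Prop := clos_refl_trans lam step.

(* Scott encoding; it is a closed normal form, so [reduces s (scott t)]
   says that evaluating s terminates with value t. *)
Fixpoint scott (t : tree) : lam :=
  match t with
  | Leaf => Lam (Lam (Var 1))
  | Node l r => Lam (Lam (App (App (Var 0) (scott l)) (scott r)))
  end.

Definition computes (s : lam) (x y : tree) : Prop :=
  reduces (App s (scott x)) (scott y).

(* The translation returns the number of constant symbols to be added and the
   list of the disjuncts. *)
Definition translation :=
  forall tau : vocabulary, LRP tau -> {k : nat & seq (LRP (add_constants tau k))}.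

(* Besides the formula, the algorithm is only given the number of constant
   symbols of the vocabulary; one algorithm serves all vocabularies. *)
Definition code_input tau (phi : LRP tau) : tree :=
  Node (tree_of_nat #|Const tau|) (code_LRP phi).

Definition code_output tau (x : {k : nat & seq (LRP (add_constants tau k))}) : tree :=
  Node (tree_of_nat (projT1 x)) (tree_of_seq (@code_LRP _) (projT2 x)).

Definition computable_on_LRP2 (T : translation) : Prop :=
  exists s : lam, closed_lam s /\
    forall (tau : vocabulary) (phi : LRP tau), LRP2 phi ->
      computes s (code_input phi) (code_output (T tau phi)).

(* Main.v *)
(* A violated reachability constraint is witnessed by finitely many nodes, which
   fresh constants can name: with constants d_0, ..., d_n for v_0, ..., v_n the
   negation of [c,R](N => psi) becomes <c,R>d_0, together with N(d) and the
   negation of psi(d), whose ground literals are NLRP^2 formulas: positive ones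
   are diamonds along the empty word or a single letter, negative ones are
   negative patterns checked at the end of the empty path. A disjunctive normal
   form does the rest.

   Computability is obtained by rewriting the translation on codes with pairing,
   case analysis and structural recursion on trees. A logical relation [rep]
   between functions of higher type and lambda terms is closed under these and
   under abstraction, so the resulting function has an implementation. *)

Require Import Defs.
From Stdlib Require List.
From Stdlib Require Import Relations Classical FunctionalExtensionality.
From mathcomp Require Import all_boot.

Set Implicit Arguments.
Unset Strict Implicit.
Unset Printing Implicit Defensive.

(** * Realizability of functions on trees *)

(** Evaluation is call-by-value and never goes under an abstraction, so closed abstractions are the
    final results. Substitution leaves them unchanged ([subst_value]), which makes the unlifted
    [subst] harmless. *)
Definition value (s : lam) : bool :=
  closed_lam s && (if s is Lam _ then true else false).

Lemma subst_closed_under s k j u : closed_under k s -> k <= j -> subst s j u = s.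
Proof.
elim: s k j => [n|s1 IH1 s2 IH2|s IH] k j /=.
- by move=> nk kj; case: eqP => // e; move: nk; rewrite e ltnNge kj.
- by move=> /andP[c1 c2] kj; rewrite (IH1 k) // (IH2 k).
- by move=> c kj; rewrite (IH k.+1).
Qed.

Lemma closed_underW s k j : closed_under k s -> k <= j -> closed_under j s.
Proof.
elim: s k j => [n|s1 IH1 s2 IH2|s IH] k j /=.
- exact: leq_trans.
- by move=> /andP[c1 c2] kj; rewrite (IH1 k) // (IH2 k).
- by move=> c kj; apply: (IH k.+1).
Qed.

Lemma subst_value s k u : value s -> subst s k u = s.
Proof. by case/andP=> cs _; apply: (subst_closed_under _ cs). Qed.

Lemma closed_value s k : value s -> closed_under k s.
Proof. by case/andP=> cs _; apply: (closed_underW cs). Qed.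

Lemma reduces_trans s t u : reduces s t -> reduces t u -> reduces s u.
Proof. exact: rt_trans. Qed.

Lemma reduces_app s s' t t' :
  reduces s s' -> reduces t t' -> reduces (App s t) (App s' t').
Proof.
move=> rs rt; apply: (@reduces_trans _ (App s' t)).
- elim: rs => [x y st|x|x y z _ IH1 _ IH2]; first exact/rt_step/step_appl.
    exact: rt_refl.
  exact: rt_trans IH1 IH2.
- elim: rt => [x y st|x|x y z _ IH1 _ IH2]; first exact/rt_step/step_appr.
    exact: rt_refl.
  exact: rt_trans IH1 IH2.
Qed.

Lemma reduces_beta s v t :
  value v -> reduces (subst s 0 v) t -> reduces (App (Lam s) v) t.
Proof.
by case: v => [n|v w|v] /andP[_ //] _; apply: reduces_trans; apply/rt_step/step_beta.
Qed.

Lemma reduces_beta2 s v w t :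
  value v -> value w -> reduces (subst (subst s 1 v) 0 w) t ->
  reduces (App (App (Lam (Lam s)) v) w) t.
Proof.
move=> vv vw; apply: reduces_trans.
apply: (@reduces_trans _ (App (Lam (subst s 1 v)) w)).
  by apply: reduces_app; [apply: reduces_beta => //=|]; apply: rt_refl.
by apply: reduces_beta => //; apply: rt_refl.
Qed.

Lemma value_scott t : value (scott t).
Proof.
rewrite /value /closed_lam; suff -> : closed_under 0 (scott t) by case: t.
by elim: t => [|l IHl r IHr] //=; rewrite (closed_underW IHl) // (closed_underW IHr).
Qed.

(* [rep x s]: the closed value [s] implements [x]; a logical relation at
   function types. *)
Class Rep (X : Type) := {
  rep : X -> lam -> Prop;
  rep_value : forall x s, rep x s -> value s
}.

Arguments rep : simpl never.

Definition realizable {X : Type} {RX : Rep X} (x : X) : Prop := exists s, rep x s.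

(** The counterpart of [rep] for terms still to be evaluated. It is closed under backward reduction
    ([eval_rep_trans]), so a realizer is verified by running it. *)
Definition eval_rep {X : Type} {RX : Rep X} (s : lam) (x : X) : Prop :=
  exists2 v, reduces s v & rep x v.

#[global] Instance Rep_tree : Rep tree.
Proof. by exists (fun x s => s = scott x) => x _ ->; apply: value_scott. Defined.

#[global] Instance Rep_arrow X Y (RX : Rep X) (RY : Rep Y) : Rep (X -> Y).
Proof.
exists (fun f s => value s /\ forall x a, rep x a -> eval_rep (App s a) (f x)).
by move=> f s [].
Defined.

#[global] Instance Rep_prod X Y (RX : Rep X) (RY : Rep Y) : Rep (X * Y).
Proof.
exists (fun p s => exists a b, [/\ rep p.1 a, rep p.2 b
                                & s = Lam (App (App (Var 0) a) b)]).
move=> p s [a [b [pa pb ->]]]; have [va vb] := (rep_value pa, rep_value pb).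
by rewrite /value /closed_lam /= !closed_value.
Defined.

Lemma eval_rep_trans X (RX : Rep X) (x : X) s t :
  reduces s t -> eval_rep t x -> eval_rep s x.
Proof. by move=> st [v tv xv]; exists v => //; apply: reduces_trans st tv. Qed.

Lemma rep_eval X (RX : Rep X) (x : X) s : rep x s -> eval_rep s x.
Proof. by move=> r; exists s => //; apply: rt_refl. Qed.

Lemma eval_rep_app X Y (RX : Rep X) (RY : Rep Y) (f : X -> Y) x s t :
  eval_rep s f -> eval_rep t x -> eval_rep (App s t) (f x).
Proof.
move=> [v sv [_ fv]] [w tw xw].
by apply: eval_rep_trans (fv _ _ xw); apply: reduces_app.
Qed.

Lemma rep_lam X Y (RX : Rep X) (RY : Rep Y) (f : X -> Y) s :
  closed_under 1 s -> (forall x a, rep x a -> eval_rep (subst s 0 a) (f x)) ->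
  rep f (Lam s).
Proof.
move=> cs fs; split; first by rewrite /value /closed_lam /= cs.
move=> x a xa; apply: eval_rep_trans (fs _ _ xa).
by apply: reduces_beta (rep_value xa) _; apply: rt_refl.
Qed.

Section Closure.
Variables (X Y Z : Type) (RX : Rep X) (RY : Rep Y) (RZ : Rep Z).

Lemma realizable_app (f : X -> Y) x : realizable f -> realizable x -> realizable (f x).
Proof. by move=> [s [_ fs]] [a /fs[b _ fb]]; exists b. Qed.

Lemma realizable_id : realizable (fun x : X => x).
Proof. by exists (Lam (Var 0)); apply: rep_lam => // x a xa; apply: rep_eval. Qed.

Lemma realizable_cst (y : Y) : realizable y -> realizable (fun _ : X => y).
Proof.
move=> [b yb]; exists (Lam b); apply: rep_lam; first exact: closed_value (rep_value yb).
by move=> x a _; rewrite (subst_value _ _ (rep_value yb)); apply: rep_eval.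
Qed.

(** This is the S combinator; with [realizable_cst] as K and [realizable_id] as I it eliminates one
    abstraction. *)
Lemma realizable_subst (f : X -> Y -> Z) (g : X -> Y) :
  realizable f -> realizable g -> realizable (fun x => f x (g x)).
Proof.
move=> [s fs] [t gt]; have [vs vt] := (rep_value fs, rep_value gt).
exists (Lam (App (App s (Var 0)) (App t (Var 0)))); apply: rep_lam.
  by rewrite /= !closed_value.
move=> x a xa; rewrite /= !subst_value //.
by do !apply: eval_rep_app; apply: rep_eval.
Qed.

Lemma realizable_pair : realizable (@pair X Y).
Proof.
exists (Lam (Lam (Lam (App (App (Var 0) (Var 2)) (Var 1))))); apply: rep_lam => // x a xa.
have va := rep_value xa; apply: rep_eval; apply: rep_lam => /=.
  by rewrite closed_value.
move=> y b yb; apply: rep_eval; exists a, b.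
by split=> //; rewrite /= (subst_value _ _ va).
Qed.

Lemma realizable_fst : realizable (@fst X Y).
Proof.
exists (Lam (App (Var 0) (Lam (Lam (Var 1))))); apply: rep_lam => // -[x y] s.
move=> [a [b [/= xa yb ->]]]; have [va vb] := (rep_value xa, rep_value yb).
apply: eval_rep_trans (rep_eval xa); apply: reduces_beta => //=.
rewrite !(subst_value _ _ va) !(subst_value _ _ vb).
by apply: reduces_beta2 => //=; rewrite subst_value //; apply: rt_refl.
Qed.

Lemma realizable_snd : realizable (@snd X Y).
Proof.
exists (Lam (App (Var 0) (Lam (Lam (Var 0))))); apply: rep_lam => // -[x y] s.
move=> [a [b [/= xa yb ->]]]; have [va vb] := (rep_value xa, rep_value yb).
apply: eval_rep_trans (rep_eval yb); apply: reduces_beta => //=.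
rewrite !(subst_value _ _ va) !(subst_value _ _ vb).
by apply: reduces_beta2 => //=; apply: rt_refl.
Qed.

(** Nested binders reduce to a single one by pairing the second variable with the first. *)
Lemma realizable_curry (f : X -> Y -> Z) :
  realizable (fun p : X * Y => f p.1 p.2) -> realizable f.
Proof.
move=> [s fs]; have vs := rep_value fs.
exists (Lam (Lam (App s (Lam (App (App (Var 0) (Var 2)) (Var 1)))))).
apply: rep_lam; first by rewrite /= closed_value.
move=> x a xa; have va := rep_value xa; apply: rep_eval => /=.
rewrite (subst_value _ _ vs); apply: rep_lam; first by rewrite /= !closed_value.
move=> y b yb; rewrite /= (subst_value _ _ vs) (subst_value _ _ va).
apply: (eval_rep_app (f := fun p : X * Y => f p.1 p.2) (x := (x, y))).
  exact: rep_eval.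
by apply: rep_eval; exists a, b.
Qed.
End Closure.

(** * Case analysis and structural recursion on trees *)

Definition tcase (X : Type) (x : X) (f : tree -> tree -> X) (t : tree) : X :=
  if t is Node l r then f l r else x.

(** The result type may be a function type, so a recursion can carry a parameter that changes from
    call to call. *)
Fixpoint trec (X : Type) (x : X) (f : tree -> tree -> X -> X -> X) (t : tree) : X :=
  if t is Node l r then f l r (trec x f l) (trec x f r) else x.

Lemma realizable_tree (t : tree) : realizable t.
Proof. by exists (scott t). Qed.

Lemma realizable_Node : realizable Node.
Proof.
exists (Lam (Lam (Lam (Lam (App (App (Var 0) (Var 3)) (Var 2)))))).
apply: rep_lam => // l _ ->; apply: rep_eval => /=; apply: rep_lam => /=.
  by rewrite closed_value // value_scott.
move=> r _ ->; apply: rep_eval.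
by rewrite /= subst_value ?value_scott.
Qed.

(* A node branch is only entered with its two subtrees, so nothing is evaluated
   before the shape of the tree is known. *)
Lemma eval_rep_case X (RX : Rep X) (x : X) (f : tree -> tree -> X) t a g :
  rep x a -> value g ->
  (forall l r, t = Node l r -> eval_rep (App (App g (scott l)) (scott r)) (f l r)) ->
  eval_rep (App (App (scott t) a) g) (tcase x f t).
Proof.
move=> xa vg; have va := rep_value xa; case: t => [_|l r gf] /=.
  apply: eval_rep_trans (rep_eval xa); apply: reduces_beta2 => //=.
  by rewrite subst_value //; apply: rt_refl.
apply: eval_rep_trans (gf _ _ erefl); apply: reduces_beta2 => //=.
by rewrite !subst_value ?value_scott //; apply: rt_refl.
Qed.

Lemma realizable_tcase X (RX : Rep X) : realizable (@tcase X).
Proof.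
exists (Lam (Lam (Lam (App (App (Var 0) (Var 2)) (Var 1))))).
apply: rep_lam => // x a xa; have va := rep_value xa; apply: rep_eval.
apply: rep_lam; first by rewrite /= closed_value.
move=> f g fg; have vg := rep_value fg; apply: rep_eval.
rewrite /= (subst_value _ _ va).
apply: rep_lam; first by rewrite /= !closed_value.
move=> t _ ->; rewrite /= (subst_value _ _ va) (subst_value _ _ vg).
apply: eval_rep_case => // l r _.
by do !apply: eval_rep_app; apply: rep_eval.
Qed.

(* [rec_loop] recurs by being applied to itself. *)
Definition rec_call (w a f t : lam) : lam := App (App (App (App w w) a) f) t.
(** The recursive calls sit under the binders for the two subtrees, so evaluation starts them only
    once a node has supplied these subtrees. *)
Definition rec_branch (w a f : lam) : lam :=
  Lam (Lam (App (App (App (App f (Var 1)) (Var 0)) (rec_call w a f (Var 1)))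
                (rec_call w a f (Var 0)))).
Definition rec_loop : lam :=
  Lam (Lam (Lam (Lam (App (App (Var 0) (Var 2)) (rec_branch (Var 5) (Var 4) (Var 3)))))).

(** The self-argument is an arbitrary value [L], so that substitution passes over it by
    [subst_value] instead of entering the body of [rec_loop]. *)
Lemma rec_loop_reduces L a f t :
  value L -> value a -> value f -> value t ->
  reduces (App (App (App (App rec_loop L) a) f) t) (App (App t a) (rec_branch L a f)).
Proof.
move=> vL va vf vt.
pose s1 := Lam (Lam (Lam (App (App (Var 0) (Var 2)) (rec_branch L (Var 4) (Var 3))))).
pose s2 := Lam (Lam (App (App (Var 0) a) (rec_branch L a (Var 3)))).
pose s3 := Lam (App (App (Var 0) a) (rec_branch L a f)).
have r1 : reduces (App rec_loop L) s1.
  by apply: reduces_beta => //=; apply: rt_refl.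
have r2 : reduces (App s1 a) s2.
  apply: reduces_beta => //=; rewrite !(subst_value _ _ vL); exact: rt_refl.
have r3 : reduces (App s2 f) s3.
  apply: reduces_beta => //=; rewrite !(subst_value _ _ vL) !(subst_value _ _ va).
  exact: rt_refl.
have r4 : reduces (App s3 t) (App (App t a) (rec_branch L a f)).
  apply: reduces_beta => //=.
  rewrite !(subst_value _ _ vL) !(subst_value _ _ va) !(subst_value _ _ vf).
  exact: rt_refl.
apply: reduces_trans r4; apply: reduces_app; last exact: rt_refl.
apply: reduces_trans r3; apply: reduces_app; last exact: rt_refl.
apply: reduces_trans r2; apply: reduces_app; last exact: rt_refl.
exact: r1.
Qed.

Lemma eval_rep_trec X (RX : Rep X) (x : X) f a g t :
  rep x a -> rep f g -> eval_rep (rec_call rec_loop a g (scott t)) (trec x f t).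
Proof.
move=> xa fg; have [va vg] := (rep_value xa, rep_value fg).
elim: t => [|l IHl r IHr].
  apply: eval_rep_trans (rec_loop_reduces (isT : value rec_loop) va vg (value_scott _)) _.
  (* At a leaf the node branch is never entered; a constant function stands in for it. *)
  apply: (eval_rep_case (f := fun _ _ => x)) => //.
  by rewrite /value /closed_lam /= !closed_value.
apply: eval_rep_trans (rec_loop_reduces (isT : value rec_loop) va vg (value_scott _)) _.
apply: (eval_rep_case (t := Node l r) (x := x)
         (f := fun l r => f l r (trec x f l) (trec x f r))) => //.
  by rewrite /value /closed_lam /= !closed_value.
move=> _ _ [<- <-].
apply: eval_rep_trans.
  apply: reduces_beta2; try exact: value_scott; rewrite /rec_call /=.
  rewrite !(subst_value _ _ va) !(subst_value _ _ vg).
  rewrite !(subst_value _ _ (value_scott _)); exact: rt_refl.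
apply: eval_rep_app IHr; apply: eval_rep_app IHl.
by do !apply: eval_rep_app; apply: rep_eval.
Qed.

Lemma realizable_trec X (RX : Rep X) : realizable (@trec X).
Proof.
exists (Lam (Lam (Lam (rec_call rec_loop (Var 2) (Var 1) (Var 0))))).
apply: rep_lam => // x a xa; have va := rep_value xa; apply: rep_eval.
rewrite /=; apply: rep_lam; first by rewrite /= closed_value.
move=> f g fg; have vg := rep_value fg; apply: rep_eval.
rewrite /= (subst_value _ _ va).
apply: rep_lam; first by rewrite /= !closed_value.
move=> t _ ->; rewrite /= (subst_value _ _ va) (subst_value _ _ vg).
exact: eval_rep_trec.
Qed.

Create HintDb real.
#[global] Hint Resolve realizable_tree realizable_Node realizable_tcase realizable_trec
  realizable_pair realizable_fst realizable_snd realizable_id : real.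

(* Bracket abstraction: the bound variables are gathered in one environment. *)
Ltac app_fun T b :=
  constr:(fun e : T => ltac:(let c := eval cbv beta in (b e) in
                             match c with ?f ?x => exact f end)).
Ltac app_arg T b :=
  constr:(fun e : T => ltac:(let c := eval cbv beta in (b e) in
                             match c with ?f ?x => exact x end)).
Ltac realize :=
  lazymatch goal with
  | |- realizable (fun e => (fun y => _)) => apply: realizable_curry; cbv beta; realize
  | |- realizable (fun e => e) => exact: realizable_id
  | |- realizable (fun _ => ?y) =>
      apply: realizable_cst; realize
  | |- realizable (fun e : ?T => @?b e) =>
      let f := app_fun T b in
      let g := app_arg T b in
      apply: (@realizable_subst _ _ _ _ _ _ f g); cbv beta; realize
  | |- realizable (?f ?x) =>
      first [solve [auto with real nocore]
            | apply: (@realizable_app _ _ _ _ f x); realize]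
  | |- realizable _ => solve [auto with real nocore]
  end.

(** * Disjunctive normal forms *)

Section Dnf.
Variable tau : vocabulary.

(* The disjuncts of a formula and those of its negation. *)
Definition dnf : Type := (seq (LRP tau) * seq (LRP tau))%type.

Definition conj_all (s1 s2 : seq (LRP tau)) : seq (LRP tau) :=
  [seq FAnd a b | a <- s1, b <- s2].

Definition dnf_true : dnf := ([:: FTrue], [::]).
Definition dnf_false : dnf := ([::], [:: FTrue]).
Definition dnf_not (d : dnf) : dnf := (d.2, d.1).
Definition dnf_and (d e : dnf) : dnf := (conj_all d.1 e.1, d.2 ++ e.2).
Definition dnf_or (d e : dnf) : dnf := (d.1 ++ e.1, conj_all d.2 e.2).

Definition any_sat (G : graph tau) (s : seq (LRP tau)) : Prop :=
  List.Exists (LRP_sat G) s.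

(** Soundness and completeness are kept apart: the disjuncts for a negated constraint always imply
    the negation, but the converse requires the fresh constants to name a violation. Soundness is
    therefore proved in every graph, completeness only in well-chosen expansions. *)
Definition dnf_sound G (d : dnf) (P : Prop) : Prop :=
  (any_sat G d.1 -> P) /\ (any_sat G d.2 -> ~ P).

Definition dnf_complete G (d : dnf) (P : Prop) : Prop :=
  (P -> any_sat G d.1) /\ (~ P -> any_sat G d.2).

Definition dnf_NLRP2 (d : dnf) : Prop :=
  List.Forall (@NLRP2 tau) d.1 /\ List.Forall (@NLRP2 tau) d.2.

Lemma any_sat_cat G s1 s2 : any_sat G (s1 ++ s2) <-> any_sat G s1 \/ any_sat G s2.
Proof. exact: List.Exists_app. Qed.

Lemma any_sat_conj G s1 s2 :
  any_sat G (conj_all s1 s2) <-> any_sat G s1 /\ any_sat G s2.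
Proof.
rewrite /conj_all; elim: s1 => [|a s1 IH] /=.
  by rewrite /any_sat !List.Exists_nil; tauto.
have map_sat : any_sat G [seq FAnd a b | b <- s2] <-> LRP_sat G a /\ any_sat G s2.
  elim: s2 {IH} => [|b s2 IH] /=; first by rewrite /any_sat !List.Exists_nil; tauto.
  by move: IH; rewrite /any_sat !List.Exists_cons /=; tauto.
rewrite any_sat_cat IH map_sat /any_sat List.Exists_cons; tauto.
Qed.

Lemma Forall_NLRP2_conj s1 s2 :
  List.Forall (@NLRP2 tau) s1 -> List.Forall (@NLRP2 tau) s2 ->
  List.Forall (@NLRP2 tau) (conj_all s1 s2).
Proof.
move=> h1 h2; elim: h1 => [|a {}s1 ha _ IH] /=; first exact: List.Forall_nil.
apply/List.Forall_app; split=> //.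
elim: {IH} h2 => [|b {}s2 hb _ IH2] /=; first exact: List.Forall_nil.
by apply: List.Forall_cons IH2; apply: NLRP2_and.
Qed.

Lemma dnf_true_sound G : dnf_sound G dnf_true True.
Proof. by split=> // /List.Exists_nil. Qed.

Lemma dnf_true_complete G : dnf_complete G dnf_true True.
Proof. by split=> // _; apply: List.Exists_cons_hd. Qed.

Lemma dnf_true_NLRP2 : dnf_NLRP2 dnf_true.
Proof. by split=> /=; repeat constructor. Qed.

Lemma dnf_false_sound G : dnf_sound G dnf_false False.
Proof. by split=> [/List.Exists_nil|_ []]. Qed.

Lemma dnf_false_complete G : dnf_complete G dnf_false False.
Proof. by split=> // _; apply: List.Exists_cons_hd. Qed.

Lemma dnf_false_NLRP2 : dnf_NLRP2 dnf_false.
Proof. by split=> /=; repeat constructor. Qed.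

Lemma dnf_not_sound G d P : dnf_sound G d P -> dnf_sound G (dnf_not d) (~ P).
Proof. by case=> h1 h2; split=> //= /h1 p np. Qed.

Lemma dnf_not_complete G d P : dnf_complete G d P -> dnf_complete G (dnf_not d) (~ P).
Proof. by case=> h1 h2; split=> //= /NNPP. Qed.

Lemma dnf_not_NLRP2 d : dnf_NLRP2 d -> dnf_NLRP2 (dnf_not d).
Proof. by case. Qed.

Lemma dnf_and_sound G d e P Q :
  dnf_sound G d P -> dnf_sound G e Q -> dnf_sound G (dnf_and d e) (P /\ Q).
Proof.
move=> [p1 p2] [q1 q2]; split; rewrite /= ?any_sat_conj ?any_sat_cat; tauto.
Qed.

Lemma dnf_and_complete G d e P Q :
  dnf_complete G d P -> dnf_complete G e Q -> dnf_complete G (dnf_and d e) (P /\ Q).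
Proof.
move=> [p1 p2] [q1 q2]; split; rewrite /= ?any_sat_conj ?any_sat_cat; first tauto.
by move=> /not_and_or; tauto.
Qed.

Lemma dnf_and_NLRP2 d e : dnf_NLRP2 d -> dnf_NLRP2 e -> dnf_NLRP2 (dnf_and d e).
Proof.
by move=> [p1 p2] [q1 q2]; split; [apply: Forall_NLRP2_conj|apply/List.Forall_app].
Qed.

Lemma dnf_or_sound G d e P Q :
  dnf_sound G d P -> dnf_sound G e Q -> dnf_sound G (dnf_or d e) (P \/ Q).
Proof.
move=> [p1 p2] [q1 q2]; split; rewrite /= ?any_sat_conj ?any_sat_cat; tauto.
Qed.

Lemma dnf_or_complete G d e P Q :
  dnf_complete G d P -> dnf_complete G e Q -> dnf_complete G (dnf_or d e) (P \/ Q).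
Proof.
move=> [p1 p2] [q1 q2]; split; rewrite /= ?any_sat_conj ?any_sat_cat; first tauto.
by move=> /not_or_and; tauto.
Qed.

Lemma dnf_or_NLRP2 d e : dnf_NLRP2 d -> dnf_NLRP2 e -> dnf_NLRP2 (dnf_or d e).
Proof.
by move=> [p1 p2] [q1 q2]; split; [apply/List.Forall_app|apply: Forall_NLRP2_conj].
Qed.

Lemma dnf_sat_exact G s t P :
  (LRP_sat G s <-> P) -> (LRP_sat G t <-> ~ P) ->
  dnf_sound G ([:: s], [:: t]) P /\ dnf_complete G ([:: s], [:: t]) P.
Proof.
move=> hs ht; rewrite /dnf_sound /dnf_complete /any_sat /= !List.Exists_cons.
by rewrite !List.Exists_nil; tauto.
Qed.

Lemma routing_path_eps (G : graph tau) a b : routing_path (G := G) REps a b <-> a = b.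
Proof.
split=> [[w [Lw]]|->]; last by exists [::]; split=> //; constructor.
by inversion Lw.
Qed.

Lemma routing_path_letter (G : graph tau) l a b :
  routing_path (G := G) (RLetter l) a b <-> letter_step l a b.
Proof.
split=> [[w [Lw]]|ab]; last first.
  by exists [:: l]; split; [constructor | exists b].
by inversion Lw; subst=> /= -[d [ad <-]].
Qed.

Lemma FAnd_sat (G : graph tau) a b : LRP_sat G (FAnd a b) <-> LRP_sat G a /\ LRP_sat G b.
Proof. by []. Qed.

Lemma FDiamond_sat (G : graph tau) c1 R c2 :
  LRP_sat G (FDiamond c1 R c2) <-> routing_path R (const G c1) (const G c2).
Proof.
split=> [sat|path h].
  apply: NNPP => npath; apply: sat => a path rho /= e _ ec.
  by apply: npath; rewrite -ec e.
(* This assignment puts [v_0] on the node named [c2], against the conclusion of the pattern. *)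
exact: (h _ path (fun=> const G c2) erefl).
Qed.
End Dnf.

(** * The translation *)

Section Embedding.
Variables (tau : vocabulary) (k : nat).
Local Notation tau' := (add_constants tau k).

Definition emb_term n (t : term tau n) : term tau' n :=
  match t with TVar i => TVar i | TConst c => @TConst tau' n (inl c) end.

Definition emb_atom n (A : atom tau n) : atom tau' n :=
  match A with
  | AEq t t' => AEq (emb_term t) (emb_term t')
  | AUnary u t => @AUnary tau' n u (emb_term t)
  | AEdge t f t' => @AEdge tau' n (emb_term t) f (emb_term t')
  end.

Fixpoint emb_qf n (psi : qf tau n) : qf tau' n :=
  match psi with
  | QTrue => QTrue
  | QFalse => QFalse
  | QAtom A => QAtom (emb_atom A)
  | QNot p => QNot (emb_qf p)
  | QAnd p q => QAnd (emb_qf p) (emb_qf q)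
  | QOr p q => QOr (emb_qf p) (emb_qf q)
  end.

Definition emb_letter (l : letter tau) : letter tau' :=
  match l with
  | LFwd f => @LFwd tau' f
  | LBwd f => @LBwd tau' f
  | LUnary u => @LUnary tau' u
  | LNotUnary u => @LNotUnary tau' u
  | LConst c => @LConst tau' (inl c)
  | LNotConst c => @LNotConst tau' (inl c)
  end.

Fixpoint emb_routing (R : routing tau) : routing tau' :=
  match R with
  | REmpty => REmpty
  | REps => REps
  | RLetter l => RLetter (emb_letter l)
  | RCat R1 R2 => RCat (emb_routing R1) (emb_routing R2)
  | RAlt R1 R2 => RAlt (emb_routing R1) (emb_routing R2)
  | RStar R1 => RStar (emb_routing R1)
  end.

Lemma qf_vars_emb n (psi : qf tau n) : qf_vars (emb_qf psi) = qf_vars psi.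
Proof.
elim: psi => //= [[t t'|u t|t f t']|p -> q ->|p -> q ->] //=.
- by case: t => ?; case: t' => ?.
- by case: t.
- by case: t => ?; case: t' => ?.
Qed.

Lemma emb_pattern_vars (p : pattern tau) :
  all (mem (ord0 :: nbhd_vars (pnbhd p))) (qf_vars (emb_qf (pconcl p))).
Proof. by rewrite qf_vars_emb; apply: pvarsP. Qed.

Definition emb_pattern (p : pattern tau) : pattern tau' :=
  @Pattern tau' (pdim p) (pnbhd p) (emb_qf (pconcl p)) (emb_pattern_vars p).

Definition reduct (G : graph tau') : graph tau :=
  @Graph tau (node G) (@edge tau' G) (fun c => const G (inl c)) (@unary tau' G).

Lemma emb_qf_sat (G : graph tau') n (rho : 'I_n.+1 -> node G) (psi : qf tau n) :
  qf_sat rho (emb_qf psi) <-> qf_sat (G := reduct G) rho psi.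
Proof.
elim: psi => //= [A|p IH|p IHp q IHq|p IHp q IHq]; [|tauto|tauto|tauto].
by case: A => [[i|c] [j|d]|u [i|c]|[i|c] f [j|d]].
Qed.

Lemma emb_word_path (G : graph tau') w a b :
  word_path (G := G) (map emb_letter w) a b <-> word_path (G := reduct G) w a b.
Proof.
elim: w a => [|l w IH] a //=.
by split=> -[d [s p]]; exists d; split; [|apply/IH| |apply/IH]; move: s; case: l.
Qed.

Lemma lang_emb R w : lang R w -> lang (emb_routing R) (map emb_letter w).
Proof.
elim=> {R w} /= [|l|R1 R2 w1 w2 _ h1 _ h2|R1 R2 w _ h|R1 R2 w _ h|R|R w1 w2 _ h1 _ h2];
  rewrite ?map_cat.
- exact: lang_eps.
- exact: lang_letter.
- exact: lang_cat.
- exact: lang_altl.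
- exact: lang_altr.
- exact: lang_star0.
- exact: lang_starS.
Qed.

(** An embedded expression mentions no new constant, so its words come from words over the old
    letters. *)
Lemma lang_emb_inv R w : lang (emb_routing R) w ->
  exists2 v, lang R v & w = map emb_letter v.
Proof.
elim: R w => [||l|R1 IH1 R2 IH2|R1 IH1 R2 IH2|R IH] w /= L.
- by inversion L.
- by inversion L; exists [::] => //; constructor.
- by inversion L; exists [:: l] => //; constructor.
- inversion L as [| |? ? w1 w2 L1 L2| | | |]; subst.
  have [v1 Lv1 ->] := IH1 _ L1; have [v2 Lv2 ->] := IH2 _ L2.
  by exists (v1 ++ v2); [constructor | rewrite map_cat].
- inversion L as [| | |? ? ? L1|? ? ? L1| |]; subst.
    by have [v Lv ->] := IH1 _ L1; exists v => //; apply: lang_altl.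
  by have [v Lv ->] := IH2 _ L1; exists v => //; apply: lang_altr.
(* An inner induction on the derivation, since the rest of a starred word belongs to the same
   starred expression. *)
- remember (RStar (emb_routing R)) as S eqn:eS; elim: L eS => //=.
    by move=> R0 _; exists [::] => //; constructor.
  move=> R0 w1 w2 L1 _ _ IH2 [e]; subst R0.
  have [v1 Lv1 ->] := IH _ L1; have [v2 Lv2 ->] := IH2 erefl.
  by exists (v1 ++ v2); [constructor | rewrite map_cat].
Qed.

Lemma emb_routing_path (G : graph tau') R a b :
  routing_path (G := G) (emb_routing R) a b <-> routing_path (G := reduct G) R a b.
Proof.
split=> [[w [/lang_emb_inv[v Lv ->] /emb_word_path p]]|[w [Lw p]]].
  by exists v.
by exists (map emb_letter w); split; [apply: lang_emb | apply/emb_word_path].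
Qed.

Lemma emb_reach_sat (G : graph tau') c R p :
  reach_sat G (inl c : Const tau') (emb_routing R) (emb_pattern p) <->
  reach_sat (reduct G) c R p.
Proof.
split=> h a path rho e N.
  by apply/(emb_qf_sat (G := G)); apply: (h a) => //; apply/emb_routing_path.
by apply/emb_qf_sat; apply: (h a) => //; apply/emb_routing_path.
Qed.

Lemma emb_only_negative n b (psi : qf tau n) :
  atoms_negative_in b (emb_qf psi) = atoms_negative_in b psi.
Proof. by elim: psi b => //= p IHp q IHq b; rewrite IHp IHq. Qed.

Lemma emb_admissible p : LRP2_admissible p -> LRP2_admissible (emb_pattern p).
Proof.
case=> [[i [j [e d]]]|[i [f [j [e d]]]]|neg].
- by apply: Or31; exists i, j; rewrite /= e.
- by apply: Or32; exists i, f, j; rewrite /= e.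
- by apply: Or33; rewrite /negative_pattern /only_negative /= emb_only_negative.
Qed.

(** * Grounding: replacing variables by constants *)

Section Ground.
Variables (n : nat) (sigma : 'I_n.+1 -> Const tau').

Definition ground_term (t : term tau n) : Const tau' :=
  match t with TVar i => sigma i | TConst c => inl c end.

(** Dimension 0 is the least one a pattern can have; it still provides the variable [v_0], which
    does not occur in a ground atom. *)
Definition ground_atom (A : atom tau n) : atom tau' 0 :=
  match A with
  | AEq t t' => AEq (TConst (ground_term t)) (TConst (ground_term t'))
  | AUnary u t => @AUnary tau' 0 u (TConst (ground_term t))
  | AEdge t f t' => @AEdge tau' 0 (TConst (ground_term t)) f (TConst (ground_term t'))
  end.

Definition pos_literal (A : atom tau n) : LRP tau' :=
  match A with
  | AEq t t' => FDiamond (ground_term t) REps (ground_term t')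
  | AUnary u t =>
      FDiamond (ground_term t) (RLetter (@LUnary tau' u)) (ground_term t)
  | AEdge t f t' =>
      FDiamond (ground_term t) (RLetter (@LFwd tau' f)) (ground_term t')
  end.

Lemma neg_atom_vars A : all (mem [:: ord0 : 'I_1]) (qf_vars (QNot (QAtom (ground_atom A)))).
Proof. by case: A. Qed.

Definition neg_atom_pattern (A : atom tau n) : pattern tau' :=
  @Pattern tau' 0 [::] (QNot (QAtom (ground_atom A))) (neg_atom_vars A).

(* Any constant can serve as the source, since the pattern is ground. *)
Definition neg_literal (A : atom tau n) : LRP tau' :=
  FReach (sigma ord0) REps (neg_atom_pattern A).

Fixpoint dnf_qf (psi : qf tau n) : dnf tau' :=
  match psi with
  | QTrue => dnf_true tau'
  | QFalse => dnf_false tau'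
  | QAtom A => ([:: pos_literal A], [:: neg_literal A])
  | QNot p => dnf_not (dnf_qf p)
  | QAnd p q => dnf_and (dnf_qf p) (dnf_qf q)
  | QOr p q => dnf_or (dnf_qf p) (dnf_qf q)
  end.

Definition ground_nbhd (N : nbhd tau n) : LRP tau' :=
  foldr (fun e => FAnd (FDiamond (sigma e.1.1) (RLetter (@LFwd tau' e.1.2)) (sigma e.2)))
    FTrue N.

Section Semantics.
Variable G : graph tau'.
Let rho (i : 'I_n.+1) : node (reduct G) := const G (sigma i).

Lemma ground_termE t : const G (ground_term t) = term_val (G := reduct G) rho t.
Proof. by case: t. Qed.

Lemma pos_literal_sat A : LRP_sat G (pos_literal A) <-> atom_sat rho A.
Proof.
case: A => [t t'|u t|t f t']; rewrite /pos_literal FDiamond_sat.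
- by rewrite routing_path_eps !ground_termE.
- rewrite routing_path_letter /= !ground_termE; tauto.
- by rewrite routing_path_letter /= !ground_termE.
Qed.

Lemma neg_literal_sat A : LRP_sat G (neg_literal A) <-> ~ atom_sat rho A.
Proof.
(* The truth of a ground atom does not depend on the assignment. *)
have ground_sat (r : 'I_1 -> node G) : atom_sat r (ground_atom A) <-> atom_sat rho A.
  by case: A => [t t'|u t|t f t'] /=; rewrite !ground_termE.
split=> [h|nA a _ r _ _] /=; last by rewrite ground_sat.
rewrite -(ground_sat (fun=> const G (sigma ord0))).
by apply: (h (const G (sigma ord0))) => //; apply/routing_path_eps.
Qed.

(** The constants [sigma] already name the nodes of [rho], so literals and atoms are equivalent in
    every graph, and the connectives preserve this. *)
Lemma dnf_qf_exact psi :
  dnf_sound G (dnf_qf psi) (qf_sat rho psi) /\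
  dnf_complete G (dnf_qf psi) (qf_sat rho psi).
Proof.
elim: psi => /= [||A|p [s c]|p [sp cp] q [sq cq]|p [sp cp] q [sq cq]].
- by split; [apply: dnf_true_sound | apply: dnf_true_complete].
- by split; [apply: dnf_false_sound | apply: dnf_false_complete].
- by apply: dnf_sat_exact; [apply: pos_literal_sat | apply: neg_literal_sat].
- by split; [apply: dnf_not_sound | apply: dnf_not_complete].
- by split; [apply: dnf_and_sound | apply: dnf_and_complete].
- by split; [apply: dnf_or_sound | apply: dnf_or_complete].
Qed.

Lemma ground_nbhd_sat N : LRP_sat G (ground_nbhd N) <-> nbhd_sat rho N.
Proof.
elim: N => [|e N IH]; first by split=> // _ e.
rewrite /ground_nbhd [foldr _ _ _]/= -/(ground_nbhd N).
rewrite FAnd_sat IH FDiamond_sat routing_path_letter /=.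
split=> [[h1 h2] e'|h]; first by rewrite inE => /orP[/eqP->|/h2].
split; first by apply: (h e); rewrite mem_head.
by move=> e' e'N; apply: h; rewrite inE e'N orbT.
Qed.
End Semantics.

Lemma dnf_qf_NLRP2 psi : dnf_NLRP2 (dnf_qf psi).
Proof.
elim: psi => /= [||A|p|p IHp q IHq|p IHp q IHq].
- exact: dnf_true_NLRP2.
- exact: dnf_false_NLRP2.
- split; apply: List.Forall_cons; try exact: List.Forall_nil.
    by case: A => *; apply: NLRP2_diamond.
  by apply: NLRP2_reach; apply: Or33.
- exact: dnf_not_NLRP2.
- exact: dnf_and_NLRP2.
- exact: dnf_or_NLRP2.
Qed.

Lemma ground_nbhd_NLRP2 N : NLRP2 (ground_nbhd N).
Proof. by elim: N => [|e N IH]; constructor=> //; apply: NLRP2_diamond. Qed.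
End Ground.
End Embedding.

(** * Blocks of fresh constants and the translation of formulas *)

Fixpoint num_fresh tau (phi : LRP tau) : nat :=
  match phi with
  | FTrue | FFalse => 0
  | FReach _ _ p => (pdim p).+1
  | FNot a => num_fresh a
  | FAnd a b | FOr a b => num_fresh a + num_fresh b
  end.

Section Translation.
Variables (tau : vocabulary) (K : nat).
Local Notation tau' := (add_constants tau K.+1).

(* Out of range indices are sent to the first new constant. *)
Definition fresh (o : nat) : Const tau' := inr (inord o).

(* The new constants with ranks o, ..., o + pdim p name the nodes of a violation
   of the constraint. *)
Definition dnf_reach (o : nat) c R (p : pattern tau) : dnf tau' :=
  let sigma (i : 'I_(pdim p).+1) := fresh (o + i) in
  ([:: @FReach tau' (inl c) (emb_routing K.+1 R) (emb_pattern K.+1 p)],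
   conj_all [:: FAnd (@FDiamond tau' (inl c) (emb_routing K.+1 R) (sigma ord0))
                     (ground_nbhd sigma (pnbhd p))]
            (dnf_qf sigma (pconcl p)).2).

(** Each occurrence of a constraint gets its own block of constants starting at the offset [o], so
    that witnesses for the two halves of a formula can be chosen independently. *)
Fixpoint dnf_LRP (o : nat) (phi : LRP tau) : dnf tau' :=
  match phi with
  | FTrue => dnf_true tau'
  | FFalse => dnf_false tau'
  | FReach c R p => dnf_reach o c R p
  | FNot a => dnf_not (dnf_LRP o a)
  | FAnd a b => dnf_and (dnf_LRP o a) (dnf_LRP (o + num_fresh a) b)
  | FOr a b => dnf_or (dnf_LRP o a) (dnf_LRP (o + num_fresh a) b)
  end.

(** In a model of a negative disjunct the nodes named by the block form an assignment that violates
    the constraint. *)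
Lemma dnf_reach_sound G o c R p :
  dnf_sound G (dnf_reach o c R p) (reach_sat (reduct G) c R p).
Proof.
split; rewrite /= ?any_sat_conj /any_sat.
  by rewrite List.Exists_cons List.Exists_nil /= emb_reach_sat; tauto.
set sigma := fun i : 'I_(pdim p).+1 => _.
rewrite List.Exists_cons List.Exists_nil FAnd_sat FDiamond_sat emb_routing_path.
move=> [[[path /ground_nbhd_sat N]|[]]] nsat h.
have [[_ /(_ nsat) npsi] _] := dnf_qf_exact sigma G (pconcl p).
by apply: npsi; apply: h N => //; apply: path.
Qed.

Lemma dnf_LRP_sound G o phi :
  dnf_sound G (dnf_LRP o phi) (LRP_sat (reduct G) phi).
Proof.
elim: phi o => /= [||c R p|a IH|a IHa b IHb|a IHa b IHb] o.
- exact: dnf_true_sound.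
- exact: dnf_false_sound.
- exact: dnf_reach_sound.
- exact: dnf_not_sound.
- exact: dnf_and_sound.
- exact: dnf_or_sound.
Qed.

Lemma dnf_LRP_NLRP2 o phi : LRP2 phi -> dnf_NLRP2 (dnf_LRP o phi).
Proof.
elim: phi o => /= [||c R p|a IH|a IHa b IHb|a IHa b IHb] o.
- by move=> _; apply: dnf_true_NLRP2.
- by move=> _; apply: dnf_false_NLRP2.
- move=> /(emb_admissible K.+1) adm; split=> /=.
    by apply: List.Forall_cons; [apply: NLRP2_reach | apply: List.Forall_nil].
  apply: Forall_NLRP2_conj; last by have [] := dnf_qf_NLRP2 (fun i => fresh (o + i)) (pconcl p).
  apply: List.Forall_cons; last exact: List.Forall_nil.
  by apply: NLRP2_and; [apply: NLRP2_diamond | apply: ground_nbhd_NLRP2].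
- by move=> /IH-/(_ o); apply: dnf_not_NLRP2.
- by move=> [/IHa-/(_ o) da /IHb]; move/(_ (o + num_fresh a)); apply: dnf_and_NLRP2.
- by move=> [/IHa-/(_ o) da /IHb]; move/(_ (o + num_fresh a)); apply: dnf_or_NLRP2.
Qed.

(** New constants are interpreted by a function on all naturals, so that choices made for different
    blocks can be glued. *)
Definition expand (G : graph tau) (h : nat -> node G) : graph tau' :=
  @Graph tau' (node G) (@edge tau G)
    (fun c => match c with inl c => const G c | inr i => h i end) (@unary tau G).

Lemma reach_sat_violation (G : graph tau) c R p : ~ reach_sat G c R p ->
  exists rho : 'I_(pdim p).+1 -> node G,
    [/\ routing_path R (const G c) (rho ord0), nbhd_sat rho (pnbhd p)
      & ~ qf_sat rho (pconcl p)].
Proof.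
move=> nsat; apply: NNPP => none; apply: nsat => a path rho e N.
by apply: NNPP => npsi; apply: none; exists rho; rewrite e.
Qed.

(** Completeness is claimed for every interpretation that agrees with the chosen one on its block;
    in this form it survives gluing with the choices for other blocks. *)
Definition agree (T : Type) (o n : nat) (h h' : nat -> T) : Prop :=
  forall i, o <= i < o + n -> h' i = h i.

Lemma agreeSl T o m n (h1 h2 h' : nat -> T) :
  agree o (m + n) (fun i => if i < o + m then h1 i else h2 i) h' -> agree o m h1 h'.
Proof.
move=> hh i /andP[oi im]; rewrite hh ?im // oi /= addnA.
exact: leq_trans im (leq_addr _ _).
Qed.

Lemma agreeSr T o m n (h1 h2 h' : nat -> T) :
  agree o (m + n) (fun i => if i < o + m then h1 i else h2 i) h' ->
  agree (o + m) n h2 h'.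
Proof.
move=> hh i /andP[omi imn]; rewrite hh ?ltnNge ?omi //= -ltnNge addnA imn andbT.
exact: leq_trans (leq_addr _ _) omi.
Qed.

Lemma dnf_reach_complete (G : graph tau) o c R p : inhabited (node G) ->
  o + (pdim p).+1 <= K.+1 ->
  exists h, forall h', agree o (pdim p).+1 h h' ->
    dnf_complete (@expand G h') (dnf_reach o c R p) (reach_sat G c R p).
Proof.
(* With [G] in constructor form, the reduct of its expansion is convertible to [G]. *)
case: G => V E C U [x0] leK; set G := Graph E C U.
have [sat|nsat] := classic (reach_sat G c R p).
  exists (fun=> x0) => h' _; split=> // _; apply: List.Exists_cons_hd.
  exact/emb_reach_sat.
have [rho [path N npsi]] := reach_sat_violation nsat.
(* The constant of index [o + i] names the value of [v_i] in the violation; outside the block the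
   values are fillers. *)
exists (fun i => rho (inord (i - o))) => h' hh; split=> // _.
rewrite any_sat_conj.
set sigma := fun i : 'I_(pdim p).+1 => _; set G' := expand h'.
have sigmaE : (fun i => const G' (sigma i)) = rho.
  apply: functional_extensionality => i; rewrite /sigma /=.
  have lti : o + i < o + (pdim p).+1 by rewrite ltn_add2l.
  rewrite inordK ?(leq_trans lti) // hh ?leq_addr //.
  by rewrite addKn inord_val.
split.
  apply: List.Exists_cons_hd; rewrite FAnd_sat FDiamond_sat ground_nbhd_sat; split.
    apply/emb_routing_path.
    have -> : const G' (sigma ord0) = rho ord0 by rewrite -sigmaE.
    exact: path.
  by rewrite sigmaE.
have [_ [_]] := dnf_qf_exact sigma G' (pconcl p); apply; rewrite sigmaE.
exact: npsi.
Qed.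

(** For a binary connective the two blocks are adjacent and disjoint, so the two interpretations are
    glued at [o + num_fresh a]. *)
Lemma dnf_LRP_complete (G : graph tau) o phi : inhabited (node G) ->
  o + num_fresh phi <= K.+1 ->
  exists h, forall h', agree o (num_fresh phi) h h' ->
    dnf_complete (@expand G h') (dnf_LRP o phi) (LRP_sat G phi).
Proof.
move=> inh; elim: phi o => /= [||c R p|a IH|a IHa b IHb|a IHa b IHb] o leK.
- by case: inh => x0; exists (fun=> x0) => h' _; apply: dnf_true_complete.
- by case: inh => x0; exists (fun=> x0) => h' _; apply: dnf_false_complete.
- exact: dnf_reach_complete.
- by have [h hh] := IH o leK; exists h => h' /hh; apply: dnf_not_complete.
- rewrite addnA in leK.
  have [h1 hh1] := IHa o (leq_trans (leq_addr _ _) leK).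
  have [h2 hh2] := IHb _ leK.
  exists (fun i => if i < o + num_fresh a then h1 i else h2 i) => h' hh.
  by apply: dnf_and_complete; [apply: hh1 (agreeSl hh) | apply: hh2 (agreeSr hh)].
- rewrite addnA in leK.
  have [h1 hh1] := IHa o (leq_trans (leq_addr _ _) leK).
  have [h2 hh2] := IHb _ leK.
  exists (fun i => if i < o + num_fresh a then h1 i else h2 i) => h' hh.
  by apply: dnf_or_complete; [apply: hh1 (agreeSl hh) | apply: hh2 (agreeSr hh)].
Qed.
End Translation.

Lemma disjunction_sat tau (G : graph tau) s :
  LRP_sat G (disjunction s) <-> any_sat G s.
Proof.
elim: s => [|a s IH] /=; rewrite /any_sat ?List.Exists_nil ?List.Exists_cons //.
by move: IH; rewrite /any_sat; tauto.
Qed.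

(* Over a vocabulary without constants a formula may have an empty model, in
   which no constant can be interpreted. *)
Lemma satisfiable_inhabited tau (phi : LRP tau) : satisfiable phi ->
  exists2 G : graph tau, LRP_sat G phi & inhabited (node G).
Proof.
move=> [G sat]; case: (pickP (fun _ : Const tau => true)) => [c _|none].
  by exists G => //; constructor; apply: const G c.
(* Without constants there are no reachability constraints: the formula is a combination of truth
   values and has the same value in all graphs, so a one-point graph serves. *)
pose G1 := @Graph tau unit (fun _ _ _ => True) (fun=> tt) (fun _ _ => True).
exists G1; last by constructor; apply: tt.
suff : LRP_sat G1 phi <-> LRP_sat G phi by tauto.
elim: phi {sat} => //= [c|||]; [by have := none c|tauto..].
Qed.

(** One constant more than counted is added, because [inord] in [fresh] requires a nonempty
    range. *)
Definition translate : translation := fun tau phi =>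
  existT (fun k => seq (LRP (add_constants tau k)))
    (num_fresh phi).+1 (dnf_LRP (num_fresh phi) 0 phi).1.

(** A model of [phi] is expanded by constants naming violations; a model of the disjunction is cut
    down to its reduct. *)
Lemma translate_satisfiable tau (phi : LRP tau) :
  satisfiable phi <-> satisfiable (disjunction (projT2 (translate phi))).
Proof.
split=> [/satisfiable_inhabited[G sat inh]|[G /disjunction_sat sat]].
  have [h /(_ h (fun _ _ => erefl))[d _]] :=
    @dnf_LRP_complete tau (num_fresh phi) G 0 phi inh (leqnSn _).
  by exists (expand (num_fresh phi) h); apply/disjunction_sat/d.
by exists (reduct G); have [d _] := dnf_LRP_sound G 0 phi; apply: d.
Qed.

(** * The translation on codes *)

Lemma realizable_ctag n : realizable (ctag n).
Proof. rewrite /ctag; realize. Qed.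

Definition tleft : tree -> tree := tcase Leaf (fun l _ => l).
Definition tright : tree -> tree := tcase Leaf (fun _ r => r).

Lemma realizable_tleft : realizable tleft.
Proof. rewrite /tleft; realize. Qed.

Lemma realizable_tright : realizable tright.
Proof. rewrite /tright; realize. Qed.

(** Tags are unary numerals, read along the right spine; every tag from 5 on selects [x5]. *)
Definition tswitch (X : Type) (x0 x1 x2 x3 x4 x5 : X) (t : tree) : X :=
  tcase x0 (fun _ t1 => tcase x1 (fun _ t2 => tcase x2 (fun _ t3 =>
    tcase x3 (fun _ t4 => tcase x4 (fun _ _ => x5) t4) t3) t2) t1) t.

Lemma realizable_tswitch X (RX : Rep X) : realizable (@tswitch X).
Proof. rewrite /tswitch; realize. Qed.

(* Recursion on a tagged tree whose payload is a code or a pair of codes: [f] gets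
   the results for the payload and for its two halves. *)
Definition tag_rec (X : Type) (x : X) (f : tree -> tree -> X -> X -> X -> X) (t : tree) : X :=
  (trec (x, (x, x))
     (fun l r rl rr => (f l r rr.1 rr.2.1 rr.2.2, (rl.1, rr.1))) t).1.

Lemma realizable_tag_rec X (RX : Rep X) : realizable (@tag_rec X).
Proof. rewrite /tag_rec; realize. Qed.

(** Numerals are lists of leaves, so this operation both concatenates lists and adds numerals. *)
Definition tcat (s t : tree) : tree := trec t (fun l _ _ rr => Node l rr) s.

Lemma realizable_tcat : realizable tcat.
Proof. rewrite /tcat; realize. Qed.

#[global] Hint Resolve realizable_ctag realizable_tleft realizable_tright
  realizable_tswitch realizable_tag_rec realizable_tcat : real.

(** In what follows the numbers given to [ctag] are the constructor tags of the coding functions. *)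
Definition tsingle (t : tree) : tree := Node t Leaf.
Definition tand (s t : tree) : tree := ctag 4 (Node s t).
Definition tneg_pattern (A : tree) : tree :=
  Node Leaf (Node Leaf (ctag 3 (ctag 2 A))).
Definition treach (c R p : tree) : tree := ctag 2 (Node c (Node R p)).
Definition tdiamond (c R d : tree) : tree :=
  ctag 3 (treach c R (tneg_pattern (ctag 0 (Node (ctag 0 Leaf) (ctag 1 d))))).

Lemma realizable_tsingle : realizable tsingle.
Proof. rewrite /tsingle; realize. Qed.
Lemma realizable_tand : realizable tand.
Proof. rewrite /tand; realize. Qed.
Lemma realizable_tneg_pattern : realizable tneg_pattern.
Proof. rewrite /tneg_pattern; realize. Qed.
Lemma realizable_treach : realizable treach.
Proof. rewrite /treach; realize. Qed.
#[global] Hint Resolve realizable_tsingle realizable_tand realizable_tneg_pattern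
  realizable_treach : real.
Lemma realizable_tdiamond : realizable tdiamond.
Proof. rewrite /tdiamond; realize. Qed.

Definition tconj_one (a s : tree) : tree :=
  trec Leaf (fun b _ _ rr => Node (tand a b) rr) s.
Lemma realizable_tconj_one : realizable tconj_one.
Proof. rewrite /tconj_one; realize. Qed.
#[global] Hint Resolve realizable_tdiamond realizable_tconj_one : real.

Definition tconj_all (s t : tree) : tree :=
  trec Leaf (fun a _ _ rr => tcat (tconj_one a t) rr) s.
Lemma realizable_tconj_all : realizable tconj_all.
Proof. rewrite /tconj_all; realize. Qed.
#[global] Hint Resolve realizable_tconj_all : real.

Definition tdnf : Type := (tree * tree)%type.
Definition tdnf_true : tdnf := (tsingle (ctag 0 Leaf), Leaf).
Definition tdnf_false : tdnf := (Leaf, tsingle (ctag 0 Leaf)).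
Definition tdnf_not (d : tdnf) : tdnf := (d.2, d.1).
Definition tdnf_and (d e : tdnf) : tdnf := (tconj_all d.1 e.1, tcat d.2 e.2).
Definition tdnf_or (d e : tdnf) : tdnf := (tcat d.1 e.1, tconj_all d.2 e.2).

Lemma realizable_tdnf_true : realizable (tdnf_true : tree * tree).
Proof. rewrite /tdnf_true; realize. Qed.
Lemma realizable_tdnf_false : realizable (tdnf_false : tree * tree).
Proof. rewrite /tdnf_false; realize. Qed.
Lemma realizable_tdnf_not : realizable (tdnf_not : tree * tree -> tree * tree).
Proof. rewrite /tdnf_not; realize. Qed.
Lemma realizable_tdnf_and :
  realizable (tdnf_and : tree * tree -> tree * tree -> tree * tree).
Proof. rewrite /tdnf_and; realize. Qed.
Lemma realizable_tdnf_or :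
  realizable (tdnf_or : tree * tree -> tree * tree -> tree * tree).
Proof. rewrite /tdnf_or; realize. Qed.
#[global] Hint Resolve realizable_tdnf_true realizable_tdnf_false realizable_tdnf_not
  realizable_tdnf_and realizable_tdnf_or : real.

(** On codes [o] is the rank of the first constant of the block, that is the number of old constants
    plus the offset. A variable becomes its constant by addition, while an old constant keeps its
    rank. *)
Definition tground (o t : tree) : tree :=
  tcase (tcat o (tright t)) (fun _ _ => tright t) (tleft t).
Lemma realizable_tground : realizable tground.
Proof. rewrite /tground; realize. Qed.
#[global] Hint Resolve realizable_tground : real.

(** Local definitions are written as beta-redexes, which [realize] removes by beta reduction. *)
Definition tground_atom (o A : tree) : tree :=
  Node (tleft A)
    ((fun x =>
       (fun g : tree -> tree =>
         tcase (Node (g (tleft x)) (g (tright x)))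
           (fun _ s => tcase (Node (tleft x) (g (tright x)))
             (fun _ _ => Node (g (tleft x))
                              (Node (tleft (tright x)) (g (tright (tright x))))) s)
           (tleft A))
       (fun t => ctag 1 (tground o t))) (tright A)).
Lemma realizable_tground_atom : realizable tground_atom.
Proof. rewrite /tground_atom; realize. Qed.

Definition tpos_literal (o A : tree) : tree :=
  (fun x =>
     tcase (tdiamond (tground o (tleft x)) (ctag 1 Leaf) (tground o (tright x)))
       (fun _ s => tcase
         (tdiamond (tground o (tright x)) (ctag 2 (ctag 2 (tleft x))) (tground o (tright x)))
         (fun _ _ => tdiamond (tground o (tleft x)) (ctag 2 (ctag 0 (tleft (tright x))))
                              (tground o (tright (tright x)))) s)
       (tleft A)) (tright A).
Lemma realizable_tpos_literal : realizable tpos_literal.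
Proof. rewrite /tpos_literal; realize. Qed.
#[global] Hint Resolve realizable_tground_atom realizable_tpos_literal : real.

Definition tneg_literal (o A : tree) : tree :=
  treach o (ctag 1 Leaf) (tneg_pattern (tground_atom o A)).
Lemma realizable_tneg_literal : realizable tneg_literal.
Proof. rewrite /tneg_literal; realize. Qed.
#[global] Hint Resolve realizable_tneg_literal : real.

(** The recursion also visits subtrees that are not codes of formulas; on genuine codes no selected
    branch reads the results for those. *)
Definition tdnf_qf : tree -> tree -> tree * tree :=
  tag_rec (fun _ : tree => tdnf_true)
    (fun tag x rx rl rr => tswitch
      (fun _ => tdnf_true)
      (fun _ => tdnf_false)
      (fun o => (tsingle (tpos_literal o x), tsingle (tneg_literal o x)))
      (fun o => tdnf_not (rx o))
      (fun o => tdnf_and (rl o) (rr o))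
      (fun o => tdnf_or (rl o) (rr o)) tag).
Lemma realizable_tdnf_qf : realizable tdnf_qf.
Proof. rewrite /tdnf_qf; realize. Qed.

Definition tground_nbhd (o N : tree) : tree :=
  trec (ctag 0 Leaf)
    (fun e _ _ rr =>
       tand (tdiamond (tcat o (tleft e)) (ctag 2 (ctag 0 (tleft (tright e))))
                      (tcat o (tright (tright e)))) rr) N.
Lemma realizable_tground_nbhd : realizable tground_nbhd.
Proof. rewrite /tground_nbhd; realize. Qed.

Definition tnum_fresh : tree -> tree :=
  tag_rec Leaf
    (fun tag x rx rl rr => tswitch Leaf Leaf
      (Node Leaf (tleft (tright (tright x)))) rx (tcat rl rr) (tcat rl rr) tag).
Lemma realizable_tnum_fresh : realizable tnum_fresh.
Proof. rewrite /tnum_fresh; realize. Qed.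
#[global] Hint Resolve realizable_tdnf_qf realizable_tground_nbhd realizable_tnum_fresh : real.

(** Embedding into the larger vocabulary leaves codes unchanged, so [c], [R] and [p] are copied; [o]
    itself codes the constant for [v_0]. *)
Definition tdnf_reach (o c R p : tree) : tree * tree :=
  (tsingle (treach c R p),
   tconj_all (tsingle (tand (tdiamond c R o) (tground_nbhd o (tleft (tright p)))))
             (tdnf_qf (tright (tright p)) o).2).
Lemma realizable_tdnf_reach : realizable tdnf_reach.
Proof. rewrite /tdnf_reach; realize. Qed.
#[global] Hint Resolve realizable_tdnf_reach : real.

(** The right half of a formula is translated at a larger offset, so the recursion returns functions
    of the offset. *)
Definition tdnf_LRP : tree -> tree -> tree * tree :=
  tag_rec (fun _ : tree => tdnf_true)
    (fun tag x rx rl rr => tswitch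
      (fun _ => tdnf_true)
      (fun _ => tdnf_false)
      (fun o => tdnf_reach o (tleft x) (tleft (tright x)) (tright (tright x)))
      (fun o => tdnf_not (rx o))
      (fun o => tdnf_and (rl o) (rr (tcat o (tnum_fresh (tleft x)))))
      (fun o => tdnf_or (rl o) (rr (tcat o (tnum_fresh (tleft x))))) tag).
Lemma realizable_tdnf_LRP : realizable tdnf_LRP.
Proof. rewrite /tdnf_LRP; realize. Qed.
#[global] Hint Resolve realizable_tdnf_LRP : real.

(** The initial [o] is the number of old constants, which is the rank of the first new one. *)
Definition ttranslate (t : tree) : tree :=
  Node (Node Leaf (tnum_fresh (tright t))) (tdnf_LRP (tright t) (tleft t)).1.
Lemma realizable_ttranslate : realizable ttranslate.
Proof. rewrite /ttranslate; realize. Qed.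

(** * Agreement of the operations on codes with the translation *)

Lemma tcat_seq T (code : T -> tree) s t :
  tcat (tree_of_seq code s) (tree_of_seq code t) = tree_of_seq code (s ++ t).
Proof. by elim: s => //= x s IH; rewrite /tcat /= -IH. Qed.

Lemma tcat_nat m n : tcat (tree_of_nat m) (tree_of_nat n) = tree_of_nat (m + n).
Proof. by elim: m => //= m IH; rewrite /tcat /= -IH. Qed.

Section Codes.
Variable tau : vocabulary.
Local Notation codes := (tree_of_seq (@code_LRP tau)).

Definition code_dnf (d : dnf tau) : tree * tree := (codes d.1, codes d.2).

Lemma tconj_all_code s t : tconj_all (codes s) (codes t) = codes (conj_all s t).
Proof.
rewrite /conj_all; elim: s => //= a s IH.
rewrite -tcat_seq -IH /tconj_all /=; congr (tcat _ _).
by elim: t {IH} => //= b t IH; rewrite /tconj_one /= -IH.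
Qed.

Lemma tdnf_not_code d : tdnf_not (code_dnf d) = code_dnf (dnf_not d).
Proof. by []. Qed.

Lemma tdnf_and_code d e : tdnf_and (code_dnf d) (code_dnf e) = code_dnf (dnf_and d e).
Proof. by rewrite /tdnf_and /code_dnf /= tconj_all_code tcat_seq. Qed.

Lemma tdnf_or_code d e : tdnf_or (code_dnf d) (code_dnf e) = code_dnf (dnf_or d e).
Proof. by rewrite /tdnf_or /code_dnf /= tconj_all_code tcat_seq. Qed.
End Codes.

(** The left summand is enumerated first; hence old constants keep their ranks and new ones
    follow. *)
Lemma enum_sum (A B : finType) :
  enum {: A + B} = [seq inl x | x <- enum A] ++ [seq inr y | y <- enum B].
Proof. by rewrite !enumT [in LHS]unlock. Qed.

Lemma enum_rank_index (T : finType) (x : T) : enum_rank x = index x (enum T) :> nat.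
Proof.
rewrite -{2}(enum_rankK x) /enum_val index_uniq ?enum_uniq //.
by rewrite -cardE; apply: ltn_ord.
Qed.

Lemma enum_rank_inl (A B : finType) (x : A) :
  enum_rank (inl x : A + B) = enum_rank x :> nat.
Proof.
rewrite !enum_rank_index enum_sum index_cat map_f ?mem_enum // index_map //.
by move=> ? ? [].
Qed.

Lemma enum_rank_inr (A B : finType) (y : B) :
  enum_rank (inr y : A + B) = #|A| + enum_rank y :> nat.
Proof.
rewrite !enum_rank_index enum_sum index_cat size_map -cardE.
rewrite ifN; last by apply/mapP => -[].
by rewrite index_map // => ? ? [].
Qed.

Section Translate.
Variables (tau : vocabulary) (K : nat).
Local Notation tau' := (add_constants tau K.+1).

Lemma code_const_inl k c :
  @code_const (add_constants tau k) (inl c) = code_const c.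
Proof. by rewrite /code_const enum_rank_inl. Qed.

Lemma code_const_fresh o : o <= K ->
  code_const (fresh tau K o) = tree_of_nat (#|Const tau| + o).
Proof.
move=> leo; rewrite /code_const enum_rank_inr enum_rank_index index_enum_ord.
by rewrite inordK.
Qed.

Lemma code_emb_qf n (psi : qf tau n) : code_qf (emb_qf K.+1 psi) = code_qf psi.
Proof.
have code_emb_term (t : term tau n) : code_term (emb_term K.+1 t) = code_term t.
  by case: t => //= c; rewrite code_const_inl.
elim: psi => //= [A|p ->|p -> q ->|p -> q ->] //.
by case: A => * /=; rewrite !code_emb_term.
Qed.

Lemma code_emb_routing (R : routing tau) :
  code_routing (emb_routing K.+1 R) = code_routing R.
Proof.
elim: R => //= [l|R1 -> R2 ->|R1 -> R2 ->|R ->] //.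
by case: l => //= c; rewrite code_const_inl.
Qed.

Lemma code_emb_pattern (p : pattern tau) :
  code_pattern (emb_pattern K.+1 p) = code_pattern p.
Proof. by rewrite /code_pattern /= code_emb_qf. Qed.

Section Ground.
Variables (n o : nat) (leK : o + n <= K).
Let sigma (i : 'I_n.+1) := fresh tau K (o + i).
Let base : tree := tree_of_nat (#|Const tau| + o).

Lemma code_sigma i : code_const (sigma i) = tcat base (code_var i).
Proof.
rewrite code_const_fresh ?tcat_nat ?addnA //.
by rewrite (leq_trans _ leK) // leq_add2l -ltnS.
Qed.

Lemma code_sigma0 : code_const (sigma ord0) = base.
Proof. by rewrite code_sigma tcat_nat addn0. Qed.

Lemma tground_code t : tground base (code_term t) = code_const (ground_term sigma t).
Proof. by case: t => [i|c] /=; rewrite ?code_sigma ?code_const_inl. Qed.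

Lemma tground_atom_code A : tground_atom base (code_atom A) = code_atom (ground_atom sigma A).
Proof. by case: A => *; rewrite /tground_atom /= !tground_code. Qed.

Lemma tpos_literal_code A : tpos_literal base (code_atom A) = code_LRP (pos_literal sigma A).
Proof. by case: A => *; rewrite /tpos_literal /= !tground_code. Qed.

Lemma tneg_literal_code A : tneg_literal base (code_atom A) = code_LRP (neg_literal sigma A).
Proof. by rewrite /tneg_literal /= tground_atom_code code_sigma0. Qed.

(** On the code of a constructor [tag_rec] and [tswitch] compute, so the recursive cases close by
    conversion once the induction hypotheses are folded back. *)
Lemma tdnf_qf_code psi : tdnf_qf (code_qf psi) base = code_dnf (dnf_qf sigma psi).
Proof.
elim: psi => [||A|p IH|p IHp q IHq|p IHp q IHq] //=.
- rewrite -[LHS]/(tsingle (tpos_literal base (code_atom A)),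
                  tsingle (tneg_literal base (code_atom A))).
  by rewrite tpos_literal_code tneg_literal_code.
- by rewrite -tdnf_not_code -IH.
- by rewrite -tdnf_and_code -IHp -IHq.
- by rewrite -tdnf_or_code -IHp -IHq.
Qed.

Lemma tground_nbhd_code N :
  tground_nbhd base (code_nbhd N) = code_LRP (ground_nbhd sigma N).
Proof.
by elim: N => //= e N IH; rewrite /tground_nbhd /code_pattern /= !code_sigma -IH.
Qed.
End Ground.

Lemma tnum_fresh_code (phi : LRP tau) :
  tnum_fresh (code_LRP phi) = tree_of_nat (num_fresh phi).
Proof. by elim: phi => //= a IHa b IHb; rewrite -tcat_nat -IHa -IHb. Qed.

Lemma tdnf_reach_code o c R (p : pattern tau) : o + pdim p <= K ->
  tdnf_reach (tree_of_nat (#|Const tau| + o)) (code_const c) (code_routing R)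
    (code_pattern p) = code_dnf (dnf_reach K o c R p).
Proof.
move=> leK; rewrite /tdnf_reach /code_dnf /dnf_reach -tconj_all_code /=.
rewrite code_const_inl code_emb_routing code_emb_pattern.
rewrite tdnf_qf_code // tground_nbhd_code // /code_pattern /= addn0.
by rewrite code_const_fresh // (leq_trans _ leK) ?leq_addr.
Qed.

Lemma tdnf_LRP_code o (phi : LRP tau) : o + num_fresh phi <= K.+1 ->
  tdnf_LRP (code_LRP phi) (tree_of_nat (#|Const tau| + o)) = code_dnf (dnf_LRP K o phi).
Proof.
elim: phi o => [||c R p|a IH|a IHa b IHb|a IHa b IHb] o /= leK //.
- by rewrite -tdnf_reach_code // -ltnS -addnS.
- by rewrite -tdnf_not_code -IH.
- rewrite addnA in leK; rewrite -tdnf_and_code -IHb // -IHa ?(leq_trans _ leK) ?leq_addr //.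
  (* The base of the right half is the old base plus the numeral computed by [tnum_fresh]. *)
  by rewrite addnA -(tcat_nat _ (num_fresh a)) -tnum_fresh_code.
- rewrite addnA in leK; rewrite -tdnf_or_code -IHb // -IHa ?(leq_trans _ leK) ?leq_addr //.
  by rewrite addnA -(tcat_nat _ (num_fresh a)) -tnum_fresh_code.
Qed.
End Translate.

Lemma ttranslate_code tau (phi : LRP tau) :
  ttranslate (code_input phi) = code_output (translate phi).
Proof.
rewrite /ttranslate /code_output /= tnum_fresh_code; congr Node.
(* The offset 0 is made explicit to match the form of the base in [tdnf_LRP_code]. *)
by rewrite -[X in tree_of_nat X]addn0 (@tdnf_LRP_code _ (num_fresh phi)).
Qed.

(** On functions from trees to trees [rep] amounts to computation on Scott codes, so the realizer of
    [ttranslate] is the required term, for all vocabularies at once. *)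
Lemma computable_translate : computable_on_LRP2 translate.
Proof.
have [s [/andP[cs _] sP]] := realizable_ttranslate.
exists s; split=> // tau phi _.
have [v red vE] := sP (code_input phi) _ erefl.
by rewrite /computes -ttranslate_code -vE.
Qed.

Theorem theorem3 :
  exists T : translation,
    computable_on_LRP2 T /\
    forall (tau : vocabulary) (phi : LRP tau), LRP2 phi ->
      List.Forall (@NLRP2 _) (projT2 (T tau phi)) /\
      (satisfiable phi <-> satisfiable (disjunction (projT2 (T tau phi)))).
Proof.
exists translate; split=> [|tau phi lrp2]; first exact: computable_translate.
split; last exact: translate_satisfiable.
by have [] := dnf_LRP_NLRP2 (num_fresh phi) 0 lrp2.
Qed.
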